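(* Let $M>1$ be a constant having the real bounds property (defined in the context). Let $f$ be a $C^3$ irrational multicritical circle map with rotation number $\rho(f)=[a_1,a_2,\dots]$, return times $(q_n)$, and unique invariant Borel probability measure $\mu$. Suppose $\rho(f)\in\mathcal{D}_\tau$ for some $\tau\ge 0$. Then \[\dim_H(\mu)\ \ge\ \frac{1}{2\tau+\nu_1+\nu_2\log M},\] where \[\nu_1=\limsup_{n\to\infty}\frac{2\log(a_1a_2\cdots a_n)}{\log q_n},\qquad \nu_2=\limsup_{n\to\infty}\frac{n}{\log q_n}.\]
   Context: Let $\mathbb{S}^1=\mathbb{R}/\mathbb{Z}$, and let $|A|$ denote the Lebesgue measure of $A\subset\mathbb{S}^1$. A $C^r$ multicritical circle map is an orientation-preserving circle homeomorphism $f:\mathbb{S}^1\to\mathbb{S}^1$ of class $C^r$ having finitely many (at least one) critical points $c_0,\dots,c_{N-1}$ (points where $Df=0$), such that around each $c_i$, in a suitable coordinate system, $f$ takes the form $x\mapsto f(c_i)+x|x|^{p_i-1}$ for some real $p_i>1$; that is, there is a $C^r$ diffeomorphism $\phi_i$ from a neighbourhood of $c_i$ onto a neighbourhood of $0\in\mathbb{R}$ with $\phi_i(c_i)=0$ and $f(x)=f(c_i)+\phi_i(x)|\phi_i(x)|^{p_i-1}$ near $c_i$. The rotation number of $f$ with lift $F$ is $\rho(f)=\lim_n F^n(x)/n\bmod 1$, identified with its representative in $[0,1)$. The map $f$ is irrational if $\rho(f)$ is irrational; then it has a unique invariant Borel probability measure. Continued fractions. For irrational $\alpha\in(0,1)$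 write $\alpha=[a_1,a_2,\dots]=1/(a_1+1/(a_2+\cdots))$. The return times are $q_{-1}=0$, $q_0=1$, $q_n=a_nq_{n-1}+q_{n-2}$ for $n\ge1$. Diophantine classes. For $\gamma>0$, $\tau\ge0$, $\mathcal{D}(\gamma,\tau)$ is the set of real $\alpha$ with $|\alpha-p/q|\ge\gamma/|q|^{\tau+2}$ for all $p,q\in\mathbb{Z}$, $q\neq0$; $\mathcal{D}_\tau=\bigcup_{\gamma>0}\mathcal{D}(\gamma,\tau)$. Hausdorff dimension of a measure. $\dim_H(\mu)=\inf\{\dim_H(X)\mid X\subset\mathbb{S}^1\text{ measurable},\ \mu(X)=1\}$, with $\dim_H(X)$ the usual Hausdorff dimension. Dynamical partitions. Let $g$ be an irrational multicritical circle map with $\rho(g)=[a_1,a_2,\dots]$ and return times $q_n$, let $x_0$ be one of its critical points, and put $x_i=g^i(x_0)$. Let $I_n$ be the circle arc $[x_0,x_{q_n})$ if $n$ is even and $[x_{q_n},x_0)$ if $n$ is odd, and $I_n^i=g^i(I_n)$. For $n\ge 1$ the partition of $\mathbb{S}^1$ associated to $x_0$ is $\mathcal{P}_n=\{I_{n-1}^i: 0\le i<q_n\}\cup\{I_n^i:0\le i<q_{n-1}\}$. For $0\le i<q_n$ one has $I_{n+1}^i\subset I_{n-1}^i$ and $I_{n-1}^i\setminus I_{n+1}^i=\bigcup_{j=0}^{a_{n+1}-1}\Delta^{(n)}_{i,j}$, where $\Delta^{(n)}_{i,j}=I_n^{i+q_{n-1}+jq_n}$ are pairwise disjoint consecutive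 adjacent arcs; write $\Delta^{(n)}_j=\Delta^{(n)}_{0,j}$. Critical times and bridges. Let $T_n=g^{q_n}|_{I_{n-1}\setminus I_{n+1}}$, and let $r_n$ be the number of indices $0<j<a_{n+1}$ such that the closure of $\Delta^{(n)}_j$ contains a critical point of $T_n$ or $j=a_{n+1}-1$. Set $k_0^{(n)}=0$, $k_{r_n}^{(n)}=a_{n+1}-1$, and let $0<k_1^{(n)}<\dots<k_{r_n-1}^{(n)}<a_{n+1}-1$ be the indices $0<j<a_{n+1}-1$ for which the closure of $\Delta^{(n)}_j$ contains a critical point of $T_n$. For $0\le i<q_n$ and $0\le s<r_n$, the bridge is $G^{(n)}_{i,s}=\bigcup_{j=k_s^{(n)}+1}^{k_{s+1}^{(n)}-1}\Delta^{(n)}_{i,j}$ (possibly empty). Notation: for positive reals $x,y$, $x\asymp_M y$ means $M^{-1}y<x<My$. Real bounds property. A constant $M$ has the real bounds property if for every irrational multicritical circle map $g$ of class $C^3$ there is $n_0=n_0(g)\in\mathbb{N}$ such that for all $n\ge n_0$ the partition $\mathcal{P}_n$ associated to any critical point of $g$ satisfies: (1) $|I|\asymp_M|J|$ for any two adjacent atoms $I,J$ of $\mathcal{P}_n$; (2) $|I^i_{n-1}|\asymp_M|G^{(n)}_{i,s}|$ for each non-empty bridge $G^{(n)}_{i,s}$; (3) $|I^i_{n-1}|\asymp_M|\Delta^{(n)}_{i,k_s^{(n)}}|$ for all $0\le i<q_n$ and $0\le s\le r_n$; (4) $|\Delta^{(n)}_{i,j}|\asymp_M \dfrac{|I^i_{n-1}|}{\min\{j-k_s^{(n)},\,k_{s+1}^{(n)}-j\}^2}$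 for all $0\le i<q_n$, $0\le s<r_n$ and $k_s^{(n)}<j<k_{s+1}^{(n)}$; (5) $\min_{I\in\mathcal{P}_n}|I|\ge \dfrac{M^{-n}}{(a_1a_2\cdots a_n)^2}$, where $\rho(g)=[a_1,a_2,\dots]$. *)

(* Defs.v *)
From HB Require Import structures.
From mathcomp Require Import all_boot all_order all_algebra.
From mathcomp Require Import generic_quotient.
From mathcomp Require Import all_classical all_reals all_analysis.

Set Implicit Arguments.
Unset Strict Implicit.
Unset Printing Implicit Defensive.

Import Order.TTheory GRing.Theory Num.Theory.
Import numFieldNormedType.Exports.

Local Open Scope classical_set_scope.
Local Open Scope ring_scope.
Local Open Scope quotient_scope.

Section Circle.
Context (R : realType).

Definition int_rel (x y : R) : bool := x - y \is a Num.int.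

Lemma int_rel_refl : reflexive int_rel.
Proof. by move=> x; rewrite /int_rel subrr rpred0. Qed.

Lemma int_rel_sym : symmetric int_rel.
Proof. by move=> x y; rewrite /int_rel -opprB rpredN. Qed.

Lemma int_rel_trans : transitive int_rel.
Proof.
move=> y x z xy yz; rewrite /int_rel.
by rewrite -[x](subrK y) -addrA; exact: rpredD.
Qed.

Definition int_equiv : equiv_rel R :=
  EquivRel int_rel int_rel_refl int_rel_sym int_rel_trans.

(* R/Z, with the quotient topology and its Borel sigma-algebra. *)
Definition circle : Type := quotient_topology {eq_quot int_equiv}.

HB.instance Definition _ := Quotient.on circle.
HB.instance Definition _ := Choice.on circle.
HB.instance Definition _ := Topological.on circle.
HB.instance Definition _ := Pointed.on circle.
HB.instance Definition _ :=
  Measurable.copy circle (g_sigma_algebraType (@open circle)).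

Definition circle_proj (x : R) : circle := \pi_circle x.

(* The length, in [0, 1[, of the positively oriented path from x to y. *)
Definition ccw (x y : circle) : R :=
  let t : R := repr y - repr x in t - (Num.floor t)%:~R.

(* The half-open arc [x, y[, run through in the positive direction. *)
Definition circle_arc (x y : circle) : set circle := [set z | ccw x z < ccw x y].

Definition circle_measure (A : set circle) : R :=
  fine (lebesgue_measure ((circle_proj @^-1` A) `&` `[0, 1[%classic)).

Definition circle_dist (x y : circle) : R := Num.min (ccw x y) (ccw y x).

Definition diam (U : set circle) : R :=
  sup [set d | exists x y, [/\ U x, U y & d = circle_dist x y]].

(* The empty set is singled out because 0 `^ 0 = 1. *)
Definition diam_pow (s : R) (U : set circle) : \bar R :=
  if `[< U = set0 >] then 0%E else (diam U `^ s)%:E.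

Definition hausdorff_premeasure (s delta : R) (X : set circle) : \bar R :=
  ereal_inf [set (\sum_(0 <= k <oo) diam_pow s (U k))%E
            | U in [set U : nat -> set circle |
                     X `<=` \bigcup_k U k /\ forall k, diam (U k) <= delta]].

Definition hausdorff_measure (s : R) (X : set circle) : \bar R :=
  ereal_sup [set hausdorff_premeasure s delta X
            | delta in [set delta : R | 0 < delta]].

Definition hausdorff_dim (X : set circle) : \bar R :=
  ereal_inf [set s%:E
            | s in [set s : R | 0 <= s /\ hausdorff_measure s X = 0%E]].

Definition hausdorff_dim_measure (mu : set circle -> \bar R) : \bar R :=
  ereal_inf [set hausdorff_dim X
            | X in [set X : set circle | measurable X /\ mu X = 1%E]].

Definition invariant_measure (mu : set circle -> \bar R) (f : circle -> circle) :=
  forall A : set circle, measurable A -> mu (f @^-1` A) = mu A.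

End Circle.

Section ContinuedFractions.
Context (R : realType).

(* Partial quotients are indexed from 1; the value a 0 is never used. *)

(* 1 / (a_k + 1 / (a_(k+1) + ... + 1 / a_(k+n-1))) *)
Fixpoint finite_cfrac (a : nat -> nat) (k n : nat) : R :=
  if n is m.+1 then ((a k)%:R + finite_cfrac a k.+1 m)^-1 else 0.

(* alpha = [a_1, a_2, ...] *)
Definition cfrac_expansion (alpha : R) (a : nat -> nat) :=
  (forall n, (0 < n)%N -> (0 < a n)%N) /\
  (finite_cfrac a 1 n @[n --> \oo] --> alpha).

(* The pair (q_(n-1), q_n), starting from q_(-1) = 0 and q_0 = 1. *)
Fixpoint return_times (a : nat -> nat) (n : nat) : nat * nat :=
  if n is m.+1 then
    let: (p, q) := return_times a m in (q, a n * q + p)%N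
  else (0, 1)%N.

Definition return_time (a : nat -> nat) (n : nat) : nat := (return_times a n).2.

Definition diophantine (gamma tau : R) : set R :=
  [set alpha | forall p q : int, q != 0 ->
     gamma / (`|q%:~R| `^ (tau + 2)) <= `|alpha - p%:~R / q%:~R|].

Definition diophantine_class (tau : R) : set R :=
  \bigcup_(gamma in [set gamma : R | 0 < gamma]) diophantine gamma tau.

End ContinuedFractions.

Section CircleMaps.
Context (R : realType).

Definition of_class (r : nat) (U : set R) (F : R -> R) :=
  forall x, U x ->
    (forall k, (k < r)%N -> derivable (derive1n k F) x 1) /\
    {for x, continuous (derive1n r F)}.

Definition diffeomorphism (r : nat) (U V : set R) (phi : R -> R) :=
  [/\ of_class r U phi, phi @` U = V &
      exists psi : R -> R,
        of_class r V psi /\ (forall x, U x -> psi (phi x) = x)].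

Definition homeomorphism (f : circle R -> circle R) :=
  continuous f /\
  exists g : circle R -> circle R, [/\ continuous g, cancel f g & cancel g f].

Definition lift_of (f : circle R -> circle R) (F : R -> R) :=
  [/\ continuous F, {homo F : x y / x < y},
      forall x, F (x + 1) = F x + 1 &
      forall x, circle_proj (F x) = f (circle_proj x)].

(* Df(c) = 0, computed on any lift. *)
Definition critical_point (f : circle R -> circle R) (c : circle R) :=
  exists F x, [/\ lift_of f F, circle_proj x = c & is_derive x 1 F 0].

(* The normal form f(c) + phi |phi|^(p - 1) of a lift F at a lift x of c. *)
Definition power_law (r : nat) (F : R -> R) (x : R) :=
  exists (p : R) (phi : R -> R) (U V : set R),
    [/\ 1 < p,
        [/\ open U, open V, U x & V 0],
        diffeomorphism r U V phi,
        phi x = 0 &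
        \forall y \near x, F y = F x + phi y * (`|phi y| `^ (p - 1))].

Definition multicritical (r : nat) (f : circle R -> circle R) :=
  homeomorphism f /\
  exists F : R -> R,
    [/\ lift_of f F, of_class r setT F,
        finite_set [set c | critical_point f c],
        (exists c, critical_point f c) &
        forall x, critical_point f (circle_proj x) -> power_law r F x].

(* rho is the representative in [0, 1[ of the rotation number of f. *)
Definition rotation_number (f : circle R -> circle R) (rho : R) :=
  exists (F : R -> R) (l : R),
    [/\ lift_of f F,
        forall x, iter n F x / n%:R @[n --> \oo] --> l &
        rho = l - (Num.floor l)%:~R].

End CircleMaps.

Section DynamicalPartitions.
Context (R : realType).
Context (g : circle R -> circle R) (a : nat -> nat) (x0 : circle R).

Local Notation q := (return_time a).

(* I_n^i *)
Definition dyn_arc (n i : nat) : set (circle R) :=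
  iter i g @` (if odd n then circle_arc (iter (q n) g x0) x0
               else circle_arc x0 (iter (q n) g x0)).

(* P_n, for n >= 1 *)
Definition dyn_partition (n : nat) : set (set (circle R)) :=
  [set dyn_arc n.-1 i | i in [set i | (i < q n)%N]] `|`
  [set dyn_arc n i | i in [set i | (i < q n.-1)%N]].

Definition adjacent_arcs (A B : set (circle R)) :=
  A <> B /\ closure A `&` closure B !=set0.

(* Delta^(n)_(i,j), for n >= 1 *)
Definition Delta (n i j : nat) : set (circle R) :=
  dyn_arc n (i + q n.-1 + j * q n)%N.

(* The closure of Delta^(n)_j contains a critical point of the restriction T_n
   of g^(q_n) to I_(n-1) \ I_(n+1). *)
Definition critical_index (n j : nat) :=
  exists c, [/\ closure (Delta n 0 j) c,
                (dyn_arc n.-1 0 `\` dyn_arc n.+1 0) c &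
                critical_point (iter (q n) g) c].

(* The indices k_1 < ... < k_(r_n), the last one being a_(n+1) - 1. *)
Definition critical_times (n : nat) : seq nat :=
  [seq j <- iota 1 (a n.+1).-1 |
    `[< critical_index n j >] || (j == (a n.+1).-1)].

Definition num_critical_times (n : nat) : nat := size (critical_times n).

(* k_s, for s <= r_n, with k_0 = 0 *)
Definition critical_time (n s : nat) : nat := nth 0 (0 :: critical_times n) s.

(* G^(n)_(i,s) *)
Definition bridge (n i s : nat) : set (circle R) :=
  \bigcup_(j in [set j | (critical_time n s < j < critical_time n s.+1)%N])
    Delta n i j.

Definition asymp (M x y : R) := M^-1 * y < x /\ x < M * y.

Definition real_bounds_at (M : R) (n : nat) :=
  let k := critical_time n in
  let r := num_critical_times n in
  [/\ (forall I J, dyn_partition n I -> dyn_partition n J -> adjacent_arcs I J ->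
        asymp M (circle_measure I) (circle_measure J)),
      (forall i s, (i < q n)%N -> (s < r)%N -> bridge n i s !=set0 ->
        asymp M (circle_measure (dyn_arc n.-1 i)) (circle_measure (bridge n i s))),
      (forall i s, (i < q n)%N -> (s <= r)%N ->
        asymp M (circle_measure (dyn_arc n.-1 i)) (circle_measure (Delta n i (k s)))),
      (forall i s j, (i < q n)%N -> (s < r)%N -> (k s < j < k s.+1)%N ->
        asymp M (circle_measure (Delta n i j))
          (circle_measure (dyn_arc n.-1 i) / (minn (j - k s) (k s.+1 - j))%:R ^+ 2)) &
      (forall I, dyn_partition n I ->
        M ^- n / ((\prod_(1 <= i < n.+1) a i)%N%:R) ^+ 2 <= circle_measure I)].

End DynamicalPartitions.

Definition real_bounds_property (R : realType) (M : R) :=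
  forall (g : circle R -> circle R) (rho : R) (a : nat -> nat),
    multicritical 3 g -> rotation_number g rho -> irrational rho ->
    cfrac_expansion rho a ->
    exists n0 : nat, forall n, (1 <= n)%N -> (n0 <= n)%N ->
      forall x0, critical_point g x0 -> real_bounds_at g a x0 M n.

(* Main.v *)
Require Import Defs.
From mathcomp Require Import all_boot all_order all_algebra.
From mathcomp Require Import generic_quotient.
From mathcomp Require Import all_classical all_reals all_analysis.
From mathcomp Require Import ring lra zify.

Set Implicit Arguments.
Unset Strict Implicit.
Unset Printing Implicit Defensive.

Import Order.TTheory GRing.Theory Num.Theory.
Import numFieldNormedType.Exports.

Local Open Scope classical_set_scope.
Local Open Scope ring_scope.

(** The measure mu is so evenly spread at the scale of the dynamical partitions
    that every short arc J satisfies mu(J) <= C |J|^s, for each s below the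
    claimed bound; the mass distribution principle then forces every set of full
    measure to have dimension at least s.

    The even spreading comes from the rotation. Let h be the distribution
    function of mu, lifted to the real line: h(y) - h(x) is the mass of the arc
    that [x, y[ covers. Invariance of mu makes h a monotone semiconjugacy from a
    lift of f to the translation by rho ([semiconjugacy]). The points i rho with
    i < q_n are within 1/q_n of the multiples of 1/q_n modulo 1, because
    |q_n rho - p_n| <= 1/q_(n+1); so every interval longer than 3/q_n contains one
    of them modulo 1 ([rotation_orbit_meets]). If an arc J has mass above 5/q_n,
    then h(J) contains such a point, shifted by h(x_0), at distance more than 1/q_n
    from its ends, and hence also the point q_(n-1) steps later. Pulled back by h,
    this says that J contains some f^i(I_(n-1)) with i < q_n, an atom of the partition of
    level n ([heavy_arc_contains_dyn_arc]). By the real bounds its length is at least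
    d_n = M^(-n) / (a_1 ... a_n)^2, so an arc shorter than d_n has mass at most
    5/q_n.

    It remains to compare 5/q_n with the length of J when d_(n+1) <= |J| < d_n.
    The Diophantine condition yields a_(n+1) <= q_n^tau / gamma, so that
      log (1/d_(n+1)) <= n log M + 2 log (a_1 ... a_n) + 2 tau log q_n + const,
    which is at most (1/s) log q_n + const for large n, by the definitions of
    nu1 and nu2, as soon as s < 1 / (2 tau + nu1 + nu2 log M). Hence 1/q_n is at
    most a constant times d_(n+1)^s ([atom_scale_lower_bound]), and therefore at
    most that constant times |J|^s ([uniform_arc_bound]). *)

(** * Continued fractions and rotation orbits *)

(** The pair (p_(n-1), p_n) of numerators of the convergents, with p_(-1) = 1 and
    p_0 = 0, parallel to [return_times]. *)
Fixpoint numerators (a : nat -> nat) (n : nat) : nat * nat :=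
  if n is m.+1 then
    let: (p', p) := numerators a m in (p, a n * p + p')%N
  else (1, 0)%N.

Definition numerator (a : nat -> nat) (n : nat) : nat := (numerators a n).2.

Lemma return_times_fst a n : (return_times a n.+1).1 = return_time a n.
Proof. by rewrite /return_time /=; case: (return_times a n). Qed.

Lemma numerators_fst a n : (numerators a n.+1).1 = numerator a n.
Proof. by rewrite /numerator /=; case: (numerators a n). Qed.

Lemma return_timeS a n :
  return_time a n.+1 = (a n.+1 * return_time a n + (return_times a n).1)%N.
Proof. by rewrite /return_time /=; case: (return_times a n). Qed.

Lemma numeratorS a n :
  numerator a n.+1 = (a n.+1 * numerator a n + (numerators a n).1)%N.
Proof. by rewrite /numerator /=; case: (numerators a n). Qed.

Lemma cfrac_det (R : comPzRingType) a n :
  (numerators a n).1%:R * (return_time a n)%:R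
    - (numerator a n)%:R * (return_times a n).1%:R = (-1) ^+ n :> R.
Proof.
elim: n => [|n IH]; first by rewrite /= expr0 mul1r mul0r subr0.
rewrite numerators_fst return_times_fst return_timeS numeratorS exprS -IH.
rewrite !natrD !natrM; ring.
Qed.

Section Expansion.
Context (R : realType) (a : nat -> nat).
Context (a_gt0 : forall n, (0 < n)%N -> (0 < a n)%N).

Local Notation q := (return_time a).
Local Notation p := (numerator a).

Lemma return_time_gt0 n : (0 < q n)%N.
Proof.
elim: n => [//|n IH]; rewrite return_timeS.
by rewrite addn_gt0 muln_gt0 a_gt0 // IH.
Qed.

Lemma finite_cfrac_itv k n : (0 < k)%N -> 0 <= finite_cfrac R a k n <= 1.
Proof.
elim: n k => [|n IH] k k0 /=; first by rewrite lexx ler01.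
have /andP[h0 h1] := IH k.+1 isT.
have a1 : 1 <= (a k)%:R :> R by rewrite ler1n a_gt0.
rewrite invr_ge0 invf_le1; lra.
Qed.

(** The classical formula for a continued fraction cut after n partial quotients,
    as a homography of its tail t. The tail is kept inside the finite fraction, so
    that the errors of the convergents can be computed before passing to the limit. *)
Lemma finite_cfrac_split n m :
  let t := finite_cfrac R a n.+1 m in
  finite_cfrac R a 1 (n + m) =
    ((p n)%:R + t * (numerators a n).1%:R) /
    ((q n)%:R + t * (return_times a n).1%:R).
Proof.
elim: n m => [|n IH] m; first by rewrite /= mulr0 addr0 mulr1 add0r divr1.
rewrite addSnnS IH numerators_fst return_times_fst return_timeS numeratorS /=.
have /andP[t0 _] := @finite_cfrac_itv n.+2 m isT.
have a1 : 1 <= (a n.+1)%:R :> R by rewrite ler1n a_gt0.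
have q1 : 1 <= (q n)%:R :> R by rewrite ler1n return_time_gt0.
have q0 : 0 <= (return_times a n).1%:R :> R by [].
set t := finite_cfrac _ _ _ _ in t0 *.
rewrite !natrD !natrM.
field.
have : 0 <= t * (q n)%:R by rewrite mulr_ge0 //; lra.
have : 1 <= (a n.+1)%:R * (q n)%:R :> R by rewrite mulr_ege1.
move=> h1 h2; rewrite !gt_eqF //; lra.
Qed.

(** By [cfrac_det] the middle term equals 1 / (q_(n+1) + t q_n), where the tail t
    lies in [0, 1]. Its sign tells on which side of the starting point the
    q_n-th iterate returns. *)
Lemma convergent_error n m :
  (q n.+1 + q n)%:R^-1 <=
    (-1) ^+ n * ((q n)%:R * finite_cfrac R a 1 (n.+1 + m) - (p n)%:R)
    <= (q n.+1)%:R^-1.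
Proof.
rewrite finite_cfrac_split numerators_fst return_times_fst.
have /andP[t0 t1] := @finite_cfrac_itv n.+2 m isT.
set t := finite_cfrac _ _ _ _ in t0 t1 *.
have q1 : 1 <= (q n)%:R :> R by rewrite ler1n return_time_gt0.
have q2 : 1 <= (q n.+1)%:R :> R by rewrite ler1n return_time_gt0.
have tq : 0 <= t * (q n)%:R <= (q n)%:R.
  by rewrite mulr_ge0 ?ler_piMl //; lra.
case/andP: tq => tq0 tq1.
have -> : (-1) ^+ n * ((q n)%:R * (((p n.+1)%:R + t * (p n)%:R) /
    ((q n.+1)%:R + t * (q n)%:R)) - (p n)%:R) = ((q n.+1)%:R + t * (q n)%:R)^-1 :> R.
  have := cfrac_det R a n.+1; rewrite numerators_fst return_times_fst => D.
  have E : (q n)%:R * (p n.+1)%:R = (p n)%:R * (q n.+1)%:R + (-1) ^+ n :> R.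
    have -> : (-1) ^+ n = - ((-1) ^+ n.+1) :> R by rewrite exprS mulN1r opprK.
    by rewrite -D; ring.
  have S2 : (-1) ^+ n * (-1) ^+ n = 1 :> R by rewrite -expr2 sqrr_sign.
  have Q0 : (q n.+1)%:R + t * (q n)%:R != 0 by rewrite gt_eqF //; lra.
  have -> : (q n)%:R * (((p n.+1)%:R + t * (p n)%:R) /
      ((q n.+1)%:R + t * (q n)%:R)) - (p n)%:R =
      ((q n)%:R * (p n.+1)%:R - (p n)%:R * (q n.+1)%:R) /
      ((q n.+1)%:R + t * (q n)%:R) by field.
  by rewrite E [_ + _ - _]addrAC subrr add0r mulrA S2 mul1r.
rewrite natrD !lef_pV2 ?posrE; lra.
Qed.

Context (rho : R).
Context (a_rho : finite_cfrac R a 1 n @[n --> \oo] --> rho).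

Lemma convergent_bounds n :
  (q n.+1 + q n)%:R^-1 <= (-1) ^+ n * ((q n)%:R * rho - (p n)%:R)
    <= (q n.+1)%:R^-1.
Proof.
have H : (-1) ^+ n * ((q n)%:R * finite_cfrac R a 1 (n.+1 + m) - (p n)%:R)
   @[m --> \oo] --> (-1) ^+ n * ((q n)%:R * rho - (p n)%:R).
  apply: cvgMr; apply: cvgB; last exact: cvg_cst.
  apply: cvgMr; move: a_rho; rewrite -(cvg_shiftn n.+1).
  by under eq_fun do rewrite addnC.
apply/andP; split.
  apply: (cvgr_to_ge H); near=> m.
  by have /andP[] := convergent_error n m.
apply: (cvgr_to_le H); near=> m.
by have /andP[] := convergent_error n m.
Unshelve. all: by end_near. Qed.

Lemma convergent_dist n : `|(q n)%:R * rho - (p n)%:R| <= (q n.+1)%:R^-1.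
Proof.
have /andP[h1 h2] := convergent_bounds n.
have -> : `|(q n)%:R * rho - (p n)%:R| = `|(-1) ^+ n * ((q n)%:R * rho - (p n)%:R)|.
  by rewrite normrM normrX normrN1 expr1n mul1r.
by rewrite ger0_norm //; apply: le_trans h1; rewrite invr_ge0.
Qed.

Lemma return_time_leS n : (a n.+1 * q n <= q n.+1)%N.
Proof. by rewrite return_timeS leq_addr. Qed.

Lemma return_time_le_next n : (q n <= q n.+1)%N.
Proof. by apply: leq_trans (return_time_leS n); rewrite leq_pmull ?a_gt0. Qed.

(** Since p_n is invertible modulo q_n, with inverse q_(n-1) up to sign by
    [cfrac_det], every integer k is i p_n modulo q_n for some i < q_n. *)
Lemma residue_witness n (k : int) : exists (i : nat) (m : int),
  (i < q n)%N /\ (i%:Z * (p n)%:Z + m * (q n)%:Z = k).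
Proof.
have q0 : (q n)%:Z != 0 by rewrite eqz_nat -lt0n return_time_gt0.
have D := cfrac_det int a n.
set s : int := (-1) ^+ n in D.
have s2 : s * s = 1 by rewrite /s -expr2 sqrr_sign.
set p' : int := (numerators a n).1%:R in D.
set q' : int := (return_times a n).1%:R in D.
pose j : int := - (k * s * q').
have i0 : 0 <= (j %% (q n)%:Z)%Z by exact: modz_ge0.
exists `|(j %% (q n)%:Z)%Z|%N, (k * s * p' + (j %/ (q n)%:Z)%Z * (p n)%:Z).
split.
  rewrite -ltz_nat gez0_abs //.
  by apply: ltz_pmod; rewrite ltz_nat return_time_gt0.
rewrite gez0_abs //.
have E := divz_eq j (q n)%:Z.
have -> : (j %% (q n)%:Z)%Z = j - (j %/ (q n)%:Z)%Z * (q n)%:Z.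
  by rewrite [X in X - _]E addrC addKr.
rewrite /j -[RHS]mulr1 -s2 mulrA -[X in _ = _ * X]D !natz; ring.
Qed.

(** Choose k with k / q_n between A + 1/q_n and A + 2/q_n, then i < q_n with
    i p_n = k modulo q_n; replacing p_n / q_n by rho displaces the point
    i p_n / q_n by at most 1/q_n. *)
Lemma rotation_orbit_meets n (A B : R) : 3 / (q n)%:R < B - A ->
  exists (i : nat) (m : int), (i < q n)%N /\ A < i%:R * rho + m%:~R < B.
Proof.
have q0 : 0 < (q n)%:R :> R by rewrite ltr0n return_time_gt0.
rewrite ltr_pdivrMr // => AB.
pose k := Num.floor ((q n)%:R * A + 1) + 1.
have k1 : (q n)%:R * A + 1 < k%:~R by rewrite /k floorD1_gt.
have k2 : k%:~R <= (q n)%:R * A + 2.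
  rewrite /k intrD; have := floor_le ((q n)%:R * A + 1); lra.
have [i [m [iq E]]] := residue_witness n k.
exists i, m; split => //.
have {}E : i%:R * (p n)%:R + m%:~R * (q n)%:R = k%:~R :> R.
  by rewrite -E intrD !intrM !pmulrn.
have : `|i%:R * ((q n)%:R * rho - (p n)%:R)| <= 1.
  rewrite normrM normr_nat; apply: le_trans (ler_wpM2l _ (convergent_dist n)) _ => //.
  rewrite ler_pdivrMr ?ltr0n ?return_time_gt0 // mul1r ler_nat.
  by apply: leq_trans (return_time_le_next n); apply: ltnW.
rewrite ler_norml => /andP[e1 e2].
have E2 : (q n)%:R * (i%:R * rho + m%:~R) =
    i%:R * ((q n)%:R * rho - (p n)%:R) + k%:~R by rewrite -E; ring.
by rewrite -(ltr_pM2l q0) -[X in _ && X](ltr_pM2l q0) E2; apply/andP; split; lra.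
Qed.

(** The convergent p_n / q_n satisfies |rho - p_n/q_n| <= 1 / (q_n q_(n+1)), while
    the Diophantine condition bounds this distance from below, and
    a_(n+1) q_n <= q_(n+1). *)
Lemma diophantine_partial_quotient (gamma tau : R) n : 0 < gamma ->
  diophantine gamma tau rho -> (a n.+1)%:R <= gamma^-1 * (q n)%:R `^ tau.
Proof.
move=> g0 dio.
have q0 : 0 < (q n)%:R :> R by rewrite ltr0n return_time_gt0.
have q1 : 0 < (q n.+1)%:R :> R by rewrite ltr0n return_time_gt0.
have qt0 : 0 < (q n)%:R `^ tau by rewrite powR_gt0.
have qz : (q n)%:Z != 0 by rewrite eqz_nat -lt0n return_time_gt0.
have := dio (p n)%:Z (q n)%:Z qz.
rewrite -!pmulrn normr_nat powRD; last by rewrite (gt_eqF q0) implybT.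
have -> : (q n)%:R `^ 2 = (q n)%:R ^+ 2 :> R by rewrite -powR_mulrn.
have -> : `|rho - (p n)%:R / (q n)%:R| = `|(q n)%:R * rho - (p n)%:R| / (q n)%:R.
  rewrite -[X in _ = _ / X](gtr0_norm q0) -normf_div; congr (`| _ |).
  by field; rewrite gt_eqF.
move=> H.
have := le_trans H (ler_wpM2r _ (convergent_dist n)).
rewrite invr_ge0 ltW // => /(_ isT).
rewrite ler_pdivrMr ?mulr_gt0 ?exprn_gt0 // => {}H.
have aq : (a n.+1)%:R * (q n)%:R <= (q n.+1)%:R :> R.
  by rewrite -natrM ler_nat return_time_leS.
rewrite mulrC ler_pdivlMr // -(ler_pM2r q0) mulrAC.
apply: le_trans (ler_wpM2r (ltW g0) aq) _.
rewrite mulrC -ler_pdivlMr //; apply: le_trans H _.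
rewrite le_eqVlt; apply/orP; left; apply/eqP; field.
by rewrite !gt_eqF.
Qed.

End Expansion.

(** * Arcs of the circle *)

Section CircleArcs.
Context (R : realType).
Implicit Types (x y z u v w : R) (m : int).

Lemma circle_projK (z : circle R) : circle_proj (repr z) = z.
Proof. exact: reprK. Qed.

Lemma circle_projP x y : circle_proj x = circle_proj y <-> exists m, x = y + m%:~R.
Proof.
split=> [/eqmodP /intrP[m E]|[m ->]].
  by exists m; rewrite -E addrC subrK.
by apply/eqmodP; rewrite /= /int_rel addrAC subrr add0r intr_int.
Qed.

Lemma circle_projD x m : circle_proj (x + m%:~R) = circle_proj x.
Proof. by apply/circle_projP; exists m. Qed.

(** The preimage of the image of an interval is the union of its integer
    translates. *)
Lemma open_circle_proj u w : open (@circle_proj R @` `]u, w[).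
Proof.
rewrite /open /= /quotient_open.
have -> : (\pi_(circle R) @^-1` (@circle_proj R @` `]u, w[))%qT =
    \bigcup_(m in [set: int]) `]u + m%:~R, w + m%:~R[%classic.
  apply/seteqP; split=> [x [y yuw /circle_projP[m ym]]|x [m _ xm]] /=.
    exists (- m) => //=; move: yuw => /=; rewrite !in_itv /= ym rmorphN /=; lra.
  exists (x - m%:~R).
    by move: xm => /=; rewrite !in_itv /=; lra.
  by rewrite -rmorphN circle_projD.
by apply: bigcup_open => m _; exact: interval_open.
Qed.

(** Arcs are handled through their lifts to the line, where order is available. *)
Definition proj_arc u w : set (circle R) := @circle_proj R @` `[u, w[.

Lemma arcE u v w : u <= v <= w -> proj_arc u w = proj_arc u v `|` proj_arc v w.
Proof.
move=> /andP[uv vw]; rewrite /proj_arc -image_setU; congr (_ @` _).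
apply/seteqP; split=> x /=; rewrite !in_itv /=.
  move=> /andP[ux xw]; case: (ltP x v) => xv; [left|right]; lra.
case; lra.
Qed.

Lemma arcD u w m : proj_arc (u + m%:~R) (w + m%:~R) = proj_arc u w.
Proof.
apply/seteqP; split=> z [x /=]; rewrite in_itv /= => xuw <-.
  exists (x - m%:~R); last by rewrite -rmorphN circle_projD.
  by rewrite /= in_itv /=; lra.
exists (x + m%:~R); last by rewrite circle_projD.
by rewrite /= in_itv /=; lra.
Qed.

Lemma arc_fundamental u : proj_arc u (u + 1) = setT.
Proof.
apply/seteqP; split=> // z _.
rewrite -(circle_projK z); move: (repr z : R) => x.
pose m := Num.floor (x - u).
exists (x - m%:~R); last by rewrite -rmorphN circle_projD.
rewrite /= in_itv /=; have := floor_itv (x - u); rewrite -/m intrD; lra.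
Qed.

Lemma circle_proj_inj u x y :
  u <= x < u + 1 -> u <= y < u + 1 -> circle_proj x = circle_proj y -> x = y.
Proof.
move=> xu yu /circle_projP[m E].
suff m0 : m = 0 by rewrite E m0 addr0.
have h1 : m%:~R < 1 :> R by lra.
have h2 : -1 < m%:~R :> R by lra.
have : (m < 1)%R by rewrite -(ltr_int R).
have : (-1 < m)%R by rewrite -(ltr_int R) rmorphN.
lia.
Qed.

Lemma arc_disjoint u v w : u <= v <= w -> w <= u + 1 ->
  proj_arc u v `&` proj_arc v w = set0.
Proof.
move=> uvw wu; apply/seteqP; split=> // z [[x /= + <-] [y /= +]].
rewrite !in_itv /= => xuv yvw E.
have : y = x by apply: (@circle_proj_inj u) => //; lra.
lra.
Qed.

Lemma measurable_circle_open (A : set (circle R)) : open A -> measurable A.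
Proof. exact: sub_sigma_algebra. Qed.

(** A point is the complement of the open arc that turns once around the circle. *)
Lemma measurable_circle1 (z : circle R) : measurable [set z].
Proof.
rewrite -(circle_projK z); move: (repr z : R) => u.
have -> : [set circle_proj u] = ~` (@circle_proj R @` `]u, (u + 1)[).
  apply/seteqP; split=> [_ ->|y /= H].
    move=> [x /=]; rewrite in_itv /= => /andP[ux xu] E.
    have : x = u by apply: (@circle_proj_inj u) => //; lra.
    lra.
  have : proj_arc u (u + 1) y by rewrite arc_fundamental; exact: I.
  case=> x /=; rewrite in_itv /= => /andP[ux xu] E.
  have [e|ne] := eqVneq x u; first by rewrite -E e.
  exfalso; apply: H; exists x => //=.
  by rewrite in_itv /= lt_neqAle eq_sym ne ux.
apply: measurableC; apply: measurable_circle_open; exact: open_circle_proj.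
Qed.

Lemma measurable_arc u w : measurable (proj_arc u w).
Proof.
case: (ltP u w) => uw; last first.
  by rewrite /proj_arc set_itv_ge ?image_set0 // -leNgt bnd_simp.
have -> : proj_arc u w = [set circle_proj u] `|` (@circle_proj R @` `]u, w[).
  by rewrite /proj_arc -(@setU1itv _ _ _ _ false) ?bnd_simp // image_setU image_set1.
apply: measurableU; first exact: measurable_circle1.
by apply: measurable_circle_open; exact: open_circle_proj.
Qed.

End CircleArcs.

(** * The semiconjugacy given by an invariant measure *)

Section DistributionFunction.
Context (R : realType) (mu : probability (circle R) R).
Implicit Types (x y z u v w : R) (m : int).

Definition arc_mass u w : R := fine (mu (proj_arc u w)).

Lemma arc_massE u w : mu (proj_arc u w) = (arc_mass u w)%:E.
Proof. by rewrite fineK // fin_num_measure //; exact: measurable_arc. Qed.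

Lemma arc_mass_ge0 u w : 0 <= arc_mass u w.
Proof. exact/fine_ge0/measure_ge0. Qed.

Lemma arc_massD u w m : arc_mass (u + m%:~R) (w + m%:~R) = arc_mass u w.
Proof. by rewrite /arc_mass arcD. Qed.

Lemma arc_mass1 u : arc_mass u (u + 1) = 1.
Proof. by rewrite /arc_mass arc_fundamental probability_setT. Qed.

Lemma arc_mass_split u v w : u <= v <= w -> w <= u + 1 ->
  arc_mass u w = arc_mass u v + arc_mass v w.
Proof.
move=> uvw wu; apply: EFin_inj; rewrite EFinD -!arc_massE (arcE uvw).
by rewrite measureU ?arc_disjoint //; exact: measurable_arc.
Qed.

(** The distribution function of mu, lifted to the line so that it increases by 1
    on each turn. Its increments are the masses of arcs ([angleB]). *)
Definition angle x : R := (Num.floor x)%:~R + arc_mass (Num.floor x)%:~R x.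

Lemma angleD x m : angle (x + m%:~R) = angle x + m%:~R.
Proof.
rewrite /angle floorDrz ?intr_int //.
have -> : Num.floor (m%:~R : R) = m by rewrite intrKfloor.
by rewrite !intrD arc_massD addrAC.
Qed.

Lemma angleD1 x : angle (x + 1) = angle x + 1.
Proof. exact: (angleD x 1). Qed.

Lemma angleB u w : u <= w <= u + 1 -> angle w - angle u = arc_mass u w.
Proof.
move=> /andP[uw wu].
have := floor_itv u; set n := Num.floor u => /andP[nu un].
have un' : u < n%:~R + 1 by rewrite -[1]/(1%:~R) -intrD.
have n1 : arc_mass n%:~R (n%:~R + 1) = 1 by rewrite arc_mass1.
case: (ltP w (n%:~R + 1)) => wn.
  have wE : Num.floor w = n.
    by apply: floor_def; rewrite intrD wn andbT; apply: le_trans uw.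
  rewrite /angle wE -/n (@arc_mass_split n%:~R u w) ?nu ?uw //; last lra.
  ring.
have wE : Num.floor w = n + 1.
  by apply: floor_def; rewrite !intrD; lra.
rewrite /angle wE -/n intrD (@arc_mass_split u (n%:~R + 1) w) //; last lra.
have := @arc_mass_split n%:~R u (n%:~R + 1); rewrite n1 nu ltW // lexx => /(_ isT isT).
lra.
Qed.

Lemma angle_itv x : (Num.floor x)%:~R <= angle x <= (Num.floor x)%:~R + 1.
Proof.
rewrite /angle lerDl arc_mass_ge0 lerD2l /=.
have /andP[h1 h2] := floor_itv x; rewrite intrD in h2.
rewrite -[leRHS](arc_mass1 (Num.floor x)%:~R).
rewrite [leRHS](@arc_mass_split _ x) ?lexx // ?lerDl ?arc_mass_ge0 // h1 ltW //.
Qed.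

Lemma angle_dist x : `|x - angle x| <= 1.
Proof.
have := angle_itv x; have := floor_itv x; rewrite intrD ler_norml; lra.
Qed.

Lemma angle_homo : {homo angle : u w / u <= w}.
Proof.
move=> u w uw; case: (leP w (u + 1)) => wu.
  by rewrite -subr_ge0 angleB ?uw // arc_mass_ge0.
have := angle_itv u; have := angle_itv w; have := floor_itv u; have := floor_itv w.
rewrite !intrD => w1 u1.
have : (Num.floor u + 1 <= Num.floor w)%R.
  by rewrite floor_ge_int intrD; lra.
rewrite -(ler_int R) intrD; lra.
Qed.

Lemma angle_lt u w : angle u < angle w -> u < w.
Proof. by apply: contraTT; rewrite -!leNgt; exact: angle_homo. Qed.

End DistributionFunction.

Section Lifts.
Context (R : realType) (f : circle R -> circle R).
Implicit Types (x y z u v w : R) (m : int).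

Lemma liftDz F : lift_of f F -> forall x m, F (x + m%:~R) = F x + m%:~R.
Proof.
case=> _ _ F1 _.
have Fn n x : F (x + n%:R) = F x + n%:R.
  by elim: n => [|n IH]; rewrite ?addr0 // -natr1 !addrA F1 IH.
move=> x [n|n]; first by rewrite -pmulrn Fn.
rewrite NegzE rmorphN /= -pmulrn.
by apply: (addIr n.+1%:R); rewrite -Fn !subrK.
Qed.

Lemma lift_lt F : lift_of f F -> {mono F : x y / x < y}.
Proof. by case=> _ Fh _ _; exact: leW_mono (le_mono Fh). Qed.

Lemma lift_iter F n : lift_of f F -> forall x,
  circle_proj (iter n F x) = iter n f (circle_proj x).
Proof. by case=> _ _ _ Fp x; elim: n => //= n IH; rewrite Fp IH. Qed.

Lemma lift_iter_lt F n : lift_of f F -> {mono iter n F : x y / x < y}.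
Proof. by move=> FL; elim: n => //= n IH x y; rewrite (lift_lt FL) IH. Qed.

Lemma lift_iterD1 F n : lift_of f F -> forall x, iter n F (x + 1) = iter n F x + 1.
Proof. by case=> _ _ F1 _ x; elim: n => //= n ->; rewrite F1. Qed.

Lemma lift_subz F m : lift_of f F -> lift_of f (fun x => F x - m%:~R).
Proof.
move=> [Fc Fh F1 Fp]; split.
- by move=> x; apply: cvgB; [exact: Fc|exact: cvg_cst].
- by move=> x y xy; rewrite ltrD2r; exact: Fh.
- by move=> x; rewrite F1 addrAC.
- by move=> x; rewrite -rmorphN circle_projD.
Qed.

(** If F x lies in [F u, F w[ up to an integer m, then F (x + m) lies in it exactly,
    and x + m is in [u, w[ because F is increasing. *)
Lemma preimage_arc F u w : lift_of f F -> f @^-1` proj_arc (F u) (F w) = proj_arc u w.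
Proof.
move=> FL; have Fm := lift_lt FL; have FD := liftDz FL; have [_ _ _ Fp] := FL.
apply/seteqP; split=> [z|_ [x /= xuw <-]].
  rewrite -(circle_projK z); move: (repr z : R) => x [s /=].
  rewrite in_itv /= -Fp => suw /circle_projP[m sE].
  exists (x + m%:~R); last by rewrite circle_projD.
  by move: suw; rewrite /= in_itv /= sE -FD !leNgt !Fm.
exists (F x) => //=.
by move: xuw; rewrite !in_itv /= !leNgt !Fm.
Qed.

End Lifts.

Section Semiconjugacy.
Context (R : realType) (mu : probability (circle R) R).
Context (f : circle R -> circle R) (hmu : invariant_measure mu f).

(** The increments of [angle] are masses of arcs, which F preserves by
    invariance; so the displacement of [angle] under F is the same at all points. *)
Lemma angle_lift_translation F : lift_of f F ->
  exists c, forall x, angle mu (F x) = angle mu x + c.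
Proof.
move=> FL; exists (angle mu (F 0) - angle mu 0) => x.
have FD := liftDz FL; have Fm := lift_lt FL.
have H y : 0 <= y <= 1 -> angle mu (F y) = angle mu y + (angle mu (F 0) - angle mu 0).
  move=> y01.
  have F01 : F 0 <= F y <= F 0 + 1.
    by rewrite -(FD 0 1%:Z) add0r !leNgt !Fm -!leNgt.
  have E1 := angleB mu F01.
  have E2 : angle mu y - angle mu 0 = arc_mass mu 0 y by apply: angleB; rewrite add0r.
  have E3 : arc_mass mu (F 0) (F y) = arc_mass mu 0 y.
    by rewrite /arc_mass -(preimage_arc 0 y FL) hmu //; exact: measurable_arc.
  lra.
have := floor_itv x; rewrite intrD.
move: (Num.floor x) => m hm.
rewrite -(subrK m%:~R x) FD !angleD H; [lra|lra].
Qed.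

(** The displacement c of [angle] under a lift F is the translation number of F,
    because [angle] stays within 1 of the identity. Subtracting from F the integer part
    of that number leaves the translation by rho itself. *)
Lemma semiconjugacy rho : rotation_number f rho ->
  exists G, lift_of f G /\ forall x, angle mu (G x) = angle mu x + rho.
Proof.
move=> [F [l [FL Fl ->]]].
have [c Fc] := angle_lift_translation FL.
suff cl : c = l.
  exists (fun x => F x - (Num.floor l)%:~R); split; first exact: lift_subz.
  by move=> x; rewrite -mulrNz angleD Fc cl mulrNz addrA.
have Fn n : angle mu (iter n F 0) = angle mu 0 + n%:R * c.
  elim: n => [|n IH]; first by rewrite mul0r addr0.
  by rewrite /= Fc IH -natr1 mulrDl mul1r addrA.
pose K := 1 + `|angle mu 0|.
have lim1 : `|iter n.+1 F 0 / n.+1%:R - c| @[n --> \oo] --> `|l - c|.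
  apply: cvg_norm; apply: cvgB; last exact: cvg_cst.
  by have := Fl 0; rewrite -cvg_shiftS.
have lim2 : K * harmonic n @[n --> \oo] --> K * 0.
  by apply: cvgMr; exact: cvg_harmonic.
have : `|l - c| <= K * 0.
  apply: (ler_cvg_to lim1 lim2); near=> n.
  have n0 : 0 < n.+1%:R :> R by rewrite ltr0n.
  have -> : iter n.+1 F 0 / n.+1%:R - c =
     (iter n.+1 F 0 - angle mu (iter n.+1 F 0) + angle mu 0) / n.+1%:R.
    by rewrite Fn; field; rewrite gt_eqF.
  rewrite /harmonic normrM normfV [`|n.+1%:R|]gtr0_norm // ler_pM2r ?invr_gt0 //.
  by apply: le_trans (ler_normD _ _) _; rewrite lerD2r angle_dist.
rewrite mulr0 normr_le0 subr_eq0 => /eqP ->//.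
Unshelve. all: by end_near. Qed.

End Semiconjugacy.

(** * Arcs of large mass contain atoms *)

Section ArcLengths.
Context (R : realType).
Implicit Types (x y z u v w s t : R) (m : int).

Lemma le_lebesgue_measure (A B : set R) :
  A `<=` B -> (lebesgue_measure A <= lebesgue_measure B)%E.
Proof.
move=> AB; rewrite /lebesgue_measure /lebesgue_stieltjes_measure /measure_extension.
exact: le_mu_ext.
Qed.

Lemma lebesgue_measureU_le (A B : set R) :
  (lebesgue_measure (A `|` B) <= lebesgue_measure A + lebesgue_measure B)%E.
Proof.
rewrite /lebesgue_measure /lebesgue_stieltjes_measure /measure_extension.
exact: outer_measureU2.
Qed.

(** After an integer translation s lies in [0, 1[, and the points of [0, 1[ that
    project into the arc lie in [s, min(t, 1)[ or in [0, t - 1[. Monotonicity of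
    outer measure avoids asking for the measurability of A. *)
Lemma circle_measure_le_length s t (A : set (circle R)) :
  s <= t <= s + 1 -> A `<=` proj_arc s t -> circle_measure A <= t - s.
Proof.
wlog s01 : s t / 0 <= s < 1.
  move=> H st As; have := floor_itv s; rewrite intrD => hs.
  have -> : t - s = (t + (- Num.floor s)%:~R) - (s + (- Num.floor s)%:~R).
    by rewrite opprD addrACA subrr addr0.
  apply: H; rewrite ?mulrNz ?arcD //; first lra.
    by move: st; lra.
  by rewrite -mulrNz arcD.
move=> st As.
suff H : (lebesgue_measure ((@circle_proj R @^-1` A) `&` `[0%R, 1%R[%classic)
    <= (t - s)%:E)%E.
  rewrite /circle_measure -lee_fin fineK // ge0_fin_numE ?measure_ge0 //.
  exact: le_lt_trans H (ltry _).
pose B1 := `[s, Num.min t 1[%classic; pose B2 := `[0, t - 1[%classic.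
have sub : (@circle_proj R @^-1` A) `&` `[0%R, 1%R[ `<=` B1 `|` B2.
  move=> x [/As [y /=]]; rewrite !in_itv /= => yst /esym/circle_projP [m xy] x01.
  rewrite /B1 /B2 /= !in_itv /= lt_min.
  have m1 : m%:~R < 1 :> R by lra.
  have m2 : -2 < m%:~R :> R by lra.
  have : (m < 1)%R by rewrite -(ltr_int R).
  have : (-2 < m)%R by rewrite -(ltr_int R) mulrNz.
  move=> h1 h2; have [E|E] : (m = 0 \/ m = -1)%R by lia.
    by left; move: xy; rewrite E; lra.
  by right; move: xy; rewrite E mulrNz; lra.
apply: le_trans (le_lebesgue_measure sub) _.
apply: le_trans (lebesgue_measureU_le _ _) _.
have -> : (lebesgue_measure B1 = (Num.min t 1 - s)%:E)%E.
  rewrite lebesgue_measure_itv /= lte_fin -EFinB; case: ifP => //.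
  move=> /negbT; rewrite -leNgt => h; congr EFin.
  by move: h; rewrite /Num.min; case: ifP; lra.
have -> : (lebesgue_measure B2 = (Num.max (t - 1) 0)%:E)%E.
  rewrite lebesgue_measure_itv /= lte_fin; case: ifP => h.
    by rewrite -EFinB subr0 max_l // ltW.
  by rewrite max_r // leNgt h.
rewrite -EFinD lee_fin.
rewrite /Num.min /Num.max; case: ifP; case: ifP; lra.
Qed.

Lemma ccw_proj x y : x <= y < x + 1 -> ccw (circle_proj x) (circle_proj y) = y - x.
Proof.
move=> xy.
have /circle_projP[m mE] := circle_projK (circle_proj x).
have /circle_projP[k kE] := circle_projK (circle_proj y).
rewrite /ccw mE kE.
have -> : y + k%:~R - (x + m%:~R) = (y - x) + (k - m)%:~R.
  by rewrite intrD mulrNz; ring.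
have -> : Num.floor (y - x + (k - m)%:~R) = k - m.
  by apply: floor_def; rewrite intrD; lra.
by rewrite addrK.
Qed.

Lemma circle_point_above x (z : circle R) :
  exists y, x <= y < x + 1 /\ circle_proj y = z.
Proof.
have : proj_arc x (x + 1) z by rewrite arc_fundamental; exact: I.
by case=> y /=; rewrite in_itv /= => yx <-; exists y.
Qed.

Lemma circle_arc_sub x y : x <= y < x + 1 ->
  circle_arc (circle_proj x) (circle_proj y) `<=` proj_arc x y.
Proof.
move=> xy z; have [s [xs <-]] := circle_point_above x z.
rewrite /circle_arc /= !ccw_proj // ltrD2r => sy.
by exists s => //=; rewrite in_itv /=; lra.
Qed.

Lemma image_iter_arc f F (A : set (circle R)) n x y : lift_of f F ->
  A `<=` proj_arc x y -> iter n f @` A `<=` proj_arc (iter n F x) (iter n F y).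
Proof.
move=> FL Axy _ [z /Axy [s /= sxy <-] <-].
exists (iter n F s); last by rewrite (lift_iter n FL).
by move: sxy; rewrite /= !in_itv /= !leNgt !(lift_iter_lt n FL).
Qed.

End ArcLengths.

Section HeavyArcs.
Context (R : realType) (f : circle R -> circle R) (G : R -> R) (GL : lift_of f G).
Context (a : nat -> nat).
Local Notation q := (return_time a).

(** The parity of n fixes the direction in which I_n is run through; the sign
    condition makes I_n the projection of the interval between x and y, and not of
    its complement in a full turn. The iterates of the lift carry that interval into
    the one between the images of x and y. *)
Lemma dyn_arc_length n i (x y : R) (m : int) : y = iter (q n) G x + m%:~R ->
  `|y - x| < 1 -> 0 < (-1) ^+ n * (y - x) ->
  circle_measure (dyn_arc f a (circle_proj x) n i) <= `|iter i G y - iter i G x|.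
Proof.
move=> yE; rewrite ltr_norml => xy1 xy0.
have yq : iter (q n) f (circle_proj x) = circle_proj y.
  by rewrite yE circle_projD (lift_iter _ GL).
have y1 : iter i G y < iter i G x + 1.
  by rewrite -(lift_iterD1 _ GL) (lift_iter_lt _ GL); lra.
have x1 : iter i G x < iter i G y + 1.
  by rewrite -(lift_iterD1 _ GL) (lift_iter_lt _ GL); lra.
rewrite /dyn_arc yq; move: xy0; rewrite -signr_odd.
case: (odd n); rewrite ?expr1 ?expr0 ?mulN1r ?mul1r => xy0.
  have yx : iter i G y < iter i G x by rewrite (lift_iter_lt _ GL); lra.
  rewrite ltr0_norm ?subr_lt0 // opprB.
  apply: circle_measure_le_length; first lra.
  by apply: image_iter_arc => //; apply: circle_arc_sub; lra.
have yx : iter i G x < iter i G y by rewrite (lift_iter_lt _ GL); lra.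
rewrite gtr0_norm ?subr_gt0 //.
apply: circle_measure_le_length; first lra.
by apply: image_iter_arc => //; apply: circle_arc_sub; lra.
Qed.

Context (mu : probability (circle R) R) (rho : R).
Context (mu_G : forall x, angle mu (G x) = angle mu x + rho).
Context (a_gt0 : forall n, (0 < n)%N -> (0 < a n)%N).
Context (a_rho : finite_cfrac R a 1 n @[n --> \oo] --> rho).

Lemma angle_iter n x : angle mu (iter n G x) = angle mu x + n%:R * rho.
Proof.
elim: n => [|n IH]; first by rewrite mul0r addr0.
by rewrite /= mu_G IH -natr1 mulrDl mul1r addrA.
Qed.

(** Since [angle] semiconjugates G to the translation by rho, a point
    [angle x0] + i rho + m at distance more than 1/q_(n+1) from both ends of the
    interval from [angle u] to [angle w] corresponds to a lift of f^i(x0) in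
    ]u, w[. The point f^(i + q_n)(x0) has an angle at distance at most 1/q_(n+1) from
    it, so it has a lift in ]u, w[ as well. These two points bound f^i(I_n). *)
Lemma heavy_arc_contains_dyn_arc n (x0 : circle R) (u w : R) :
  u <= w <= u + 1 -> 5 / (q n.+1)%:R < angle mu w - angle mu u ->
  exists2 i, (i < q n.+1)%N & circle_measure (dyn_arc f a x0 n i) <= w - u.
Proof.
move=> uw heavy; rewrite -(circle_projK x0); move: (repr x0 : R) => x {x0}.
set e := (q n.+1)%:R^-1 in heavy.
have e0 : 0 < e by rewrite invr_gt0 ltr0n return_time_gt0.
(* An arc has mass at most 1, so 5 < q_(n+1): the return stays within a turn. *)
have e1 : e < 1.
  have : angle mu w - angle mu u <= 1.
    rewrite angleB // -(arc_mass1 mu u).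
    by rewrite (@arc_mass_split _ _ u w (u + 1)) ?lexx // lerDl arc_mass_ge0.
  by move: heavy; lra.
pose p : int := (numerator a n)%:Z.
(* The lift, closest to x, of the point where x returns after q_n steps. *)
pose y := iter (q n) G x + (- p)%:~R.
have cy : angle mu y = angle mu x + ((q n)%:R * rho - (numerator a n)%:R).
  by rewrite /y angleD angle_iter mulrNz -pmulrn addrA.
have := convergent_dist a_gt0 a_rho n; rewrite -/e ler_norml => cd.
have /andP[cs _] := convergent_bounds a_gt0 a_rho n.
have {}cs : 0 < (-1) ^+ n * ((q n)%:R * rho - (numerator a n)%:R).
  by apply: lt_le_trans cs; rewrite invr_gt0 ltr0n addn_gt0 return_time_gt0.
have yx1 : `|y - x| < 1.
  have h1 : y < x + 1.
    by apply: (@angle_lt _ mu); rewrite angleD1 cy; lra.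
  have h2 : x < y + 1.
    by apply: (@angle_lt _ mu); rewrite angleD1 cy; lra.
  rewrite ltr_norml; lra.
have yx0 : 0 < (-1) ^+ n * (y - x).
  move: cs; rewrite -signr_odd; case: (odd n); rewrite ?expr1 ?expr0 ?mulN1r ?mul1r => cs.
    by rewrite oppr_gt0 subr_lt0; apply: (@angle_lt _ mu); rewrite cy; lra.
  by rewrite subr_gt0; apply: (@angle_lt _ mu); rewrite cy; lra.
have [|i [m [iq im]]] := @rotation_orbit_meets _ _ a_gt0 _ a_rho n.+1
    (angle mu u + e - angle mu x) (angle mu w - e - angle mu x).
  by rewrite -/e; lra.
exists i => //.
apply: le_trans (dyn_arc_length i erefl yx1 yx0) _.
have x1 : u < iter i G x + m%:~R.
  by apply: (@angle_lt _ mu); rewrite angleD angle_iter; lra.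
have x2 : iter i G x + m%:~R < w.
  by apply: (@angle_lt _ mu); rewrite angleD angle_iter; lra.
have y1 : u < iter i G y + m%:~R.
  by apply: (@angle_lt _ mu); rewrite angleD angle_iter cy; lra.
have y2 : iter i G y + m%:~R < w.
  by apply: (@angle_lt _ mu); rewrite angleD angle_iter cy; lra.
rewrite ler_norml; lra.
Qed.

End HeavyArcs.

(** * Comparison of masses and lengths *)

Section LimitSuperior.
Context (R : realType).

Lemma limn_esup_lt (u : (\bar R)^nat) (l : \bar R) : (limn_esup u < l)%E ->
  exists N, forall n, (N <= n)%N -> (u n < l)%E.
Proof.
rewrite /limn_esup /limf_esup => /ereal_inf_lt[_ [V [N _ NV] <-] Vl].
exists N => n Nn; apply: le_lt_trans Vl; apply: ereal_sup_ubound.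
by exists n => //; apply: NV.
Qed.

Lemma limn_esup_ge0 (u : (\bar R)^nat) : (forall n, 0 <= u n)%E -> (0 <= limn_esup u)%E.
Proof.
move=> u0; rewrite /limn_esup /limf_esup; apply: le_ereal_inf_tmp => _ [V [N _ NV] <-].
apply: le_trans (u0 N) _; apply: ereal_sup_ubound.
by exists N => //; apply: NV => /=.
Qed.

(** In extended reals the inverse of +oo is 0 and the inverse of 0 is +oo, so a
    positive s below the inverse excludes infinite x and y, and the strict
    inequality leaves room to enlarge both of them. *)
Lemma lt_inve_split (s t L : R) (x y : \bar R) :
  0 < s -> 0 < L -> (0 <= x)%E -> (0 <= y)%E ->
  (s%:E < (t%:E + x + y * L%:E)^-1)%E ->
  exists x' y' : R, [/\ (x < x'%:E)%E, (y < y'%:E)%E & t + x' + y' * L <= s^-1].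
Proof.
move=> s0 L0.
case: x => [x| |] //; last first.
  move=> _ y0; rewrite addey // addye ?invey ?lte_fin ?ltNge ?ltW //.
  by rewrite gt_eqF // (lt_le_trans ltNy0) // mule_ge0 // lee_fin ltW.
case: y => [y| |] //; last first.
  by move=> _ _; rewrite gt0_mulye ?lte_fin // ltNge ltW.
move=> x0 y0; rewrite -EFinM -!EFinD; set d := t + x + y * L => H.
have {H} ds : d < s^-1.
  move: H; rewrite inver; case: eqP => [-> _|]; first by rewrite invr_gt0.
  move=> /eqP d0; rewrite lte_fin => sd.
  have d1 : 0 < d by rewrite -invr_gt0; apply: lt_trans sd.
  by rewrite -[d]invrK ltf_pV2 // posrE invr_gt0.
exists (x + (s^-1 - d) / 2), (y + (s^-1 - d) / 2 / L); split.
- by rewrite lte_fin; lra.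
- by rewrite lte_fin ltrDl divr_gt0 //; lra.
- by rewrite [X in _ + X <= _]mulrDl divfK ?gt_eqF // /d; lra.
Qed.

End LimitSuperior.

Section Scales.
Context (R : realType) (M : R) (hM : 1 < M) (a : nat -> nat).
Context (a_gt0 : forall n, (0 < n)%N -> (0 < a n)%N).
Local Notation q := (return_time a).

Let M0 : 0 < M. Proof. exact: lt_trans hM. Qed.

Definition quotient_prod n : R := (\prod_(1 <= i < n.+1) a i)%N%:R.

(** The lower bound that the real bounds give for the lengths of the atoms of
    level n. *)
Definition atom_scale n : R := M ^- n / quotient_prod n ^+ 2.

Lemma quotient_prod_ge1 n : 1 <= quotient_prod n.
Proof.
rewrite ler1n big_seq_cond; apply: prodn_cond_gt0 => i.
by rewrite andbT mem_index_iota => /andP[i0 _]; exact: a_gt0.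
Qed.

Lemma quotient_prodS n : quotient_prod n.+1 = quotient_prod n * (a n.+1)%:R.
Proof. by rewrite /quotient_prod big_nat_recr //= natrM. Qed.

Lemma atom_scale_gt0 n : 0 < atom_scale n.
Proof.
have A0 : 0 < quotient_prod n by apply: lt_le_trans (quotient_prod_ge1 n).
by rewrite divr_gt0 ?invr_gt0 ?exprn_gt0.
Qed.

Lemma atom_scale_le n : atom_scale n <= M^-1 ^+ n.
Proof.
rewrite exprVn ler_pdivrMr ?exprn_gt0 //; last by have := quotient_prod_ge1 n; lra.
rewrite ler_peMr ?exprn_ege1 ?quotient_prod_ge1 //.
by rewrite invr_ge0 exprn_ge0 // ltW.
Qed.

Lemma return_time_ge2 n : (1 < q n.+2)%N.
Proof.
rewrite return_timeS return_times_fst.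
have := return_time_gt0 a_gt0 n; have := return_time_gt0 a_gt0 n.+1.
have := a_gt0 (isT : (0 < n.+2)%N).
by case: (a _) => // b _; case: (q n.+1) => // c _; case: (q n) => // e _; lia.
Qed.

(** In logarithms: -log of [atom_scale] n.+1 is
    (n + 1) log M + 2 log (a_1 ... a_n) + 2 log a_(n+1). For large n the first two
    terms are below (y log M + x) log q_n + log M, with x, y slightly above the limits
    superior, and the Diophantine bound makes the last one at most
    2 tau log q_n - 2 log gamma. *)
Lemma atom_scale_lower_bound (s tau gamma rho : R) :
  finite_cfrac R a 1 n @[n --> \oo] --> rho ->
  0 < s -> 0 < gamma -> diophantine gamma tau rho ->
  (s%:E < ((2 * tau)%:E +
     limn_esup (fun n => (2 * ln (quotient_prod n) / ln (q n)%:R)%:E) +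
     limn_esup (fun n => (n%:R / ln (q n)%:R)%:E) * (ln M)%:E)^-1)%E ->
  exists2 C, 0 < C &
    exists N, forall n, (N <= n)%N -> (q n)%:R^-1 <= C * atom_scale n.+1 `^ s.
Proof.
move=> a_rho s0 gamma0 dio sD.
have L0 : 0 < ln M by rewrite ln_gt0.
have lnq n : 0 <= ln (q n)%:R :> R by rewrite ln_ge0 // ler1n return_time_gt0.
have lnA n : 0 <= ln (quotient_prod n) by rewrite ln_ge0 // quotient_prod_ge1.
have [||x [y [nu1 nu2 xy]]] := lt_inve_split s0 L0 _ _ sD.
- by apply: limn_esup_ge0 => n; rewrite lee_fin divr_ge0 ?mulr_ge0.
- by apply: limn_esup_ge0 => n; rewrite lee_fin divr_ge0.
have [N1 H1] := limn_esup_lt nu1; have [N2 H2] := limn_esup_lt nu2.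
pose K := ln M - 2 * ln gamma.
exists (expR (s * K)); first exact: expR_gt0.
exists (maxn 2 (maxn N1 N2)) => n; rewrite !geq_max => /and3P[n2 n1 n3].
have q0 : 0 < (q n)%:R :> R by rewrite ltr0n return_time_gt0.
have lq0 : 0 < ln (q n)%:R :> R.
  rewrite ln_gt0 // ltr1n; case: n n2 {n1 n3 q0} => [//|[//|n _]].
  exact: return_time_ge2.
have := H1 n n1; rewrite lte_fin ltr_pdivrMr // => {}H1.
have := H2 n n3; rewrite lte_fin ltr_pdivrMr // => {}H2.
have A0 : 0 < quotient_prod n by have := quotient_prod_ge1 n; lra.
have an0 : 0 < (a n.+1)%:R :> R by rewrite ltr0n a_gt0.
have lna : ln (a n.+1)%:R <= tau * ln (q n)%:R - ln gamma.
  have := diophantine_partial_quotient a_gt0 a_rho n gamma0 dio.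
  move=> H; have : ln (a n.+1)%:R <= ln (gamma^-1 * (q n)%:R `^ tau).
    by rewrite ler_ln ?posrE ?mulr_gt0 ?invr_gt0 ?powR_gt0.
  rewrite lnM ?posrE ?invr_gt0 ?powR_gt0 // lnV ?posrE // ln_powR; lra.
have lnd : ln (atom_scale n.+1) =
    - (n.+1%:R * ln M + 2 * (ln (quotient_prod n) + ln (a n.+1)%:R)).
  rewrite /atom_scale quotient_prodS -invfM.
  rewrite lnV ?posrE ?mulr_gt0 ?exprn_gt0 ?mulr_gt0 //.
  rewrite lnM ?posrE ?exprn_gt0 ?mulr_gt0 // !lnXn ?mulr_gt0 //.
  by rewrite lnM ?posrE // mulr_natl [2 * _]mulr_natl.
have key : - ln (atom_scale n.+1) <= s^-1 * ln (q n)%:R + K.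
  have : (2 * tau + x + y * ln M) * ln (q n)%:R <= s^-1 * ln (q n)%:R.
    by rewrite ler_pM2r.
  have : n%:R * ln M <= y * ln (q n)%:R * ln M by rewrite ler_pM2r // ltW.
  rewrite lnd -natr1 /K; lra.
rewrite /powR gt_eqF ?atom_scale_gt0 // -expRD.
rewrite -[leLHS]lnK ?posrE ?invr_gt0 // ler_expR lnV ?posrE // -mulrDr.
have := ler_wpM2l (ltW s0) key.
rewrite [s * (_ + K)]mulrDr mulVKf ?gt_eqF //; lra.
Qed.

(** The scales decrease to 0, so the length of a short arc falls between two
    consecutive ones. The bound at level n uses that the arc is shorter than the
    scale n, and the comparison with its length that it is at least the scale n.+1. *)
Lemma uniform_arc_bound (s C : R) (N : nat) (h : R -> R) :
  0 < s -> 0 < C ->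
  (forall n, (N <= n)%N -> (q n)%:R^-1 <= C * atom_scale n.+1 `^ s) ->
  (forall n (u w : R), (N <= n)%N -> u <= w <= u + 1 -> w - u < atom_scale n ->
     h w - h u <= 5 / (q n)%:R) ->
  forall u w : R, u < w -> w - u < atom_scale N -> h w - h u <= 5 * C * (w - u) `^ s.
Proof.
move=> s0 C0 HC Hh u w uw uwN.
have r0 : 0 < w - u by rewrite subr_gt0.
have ex : exists k, atom_scale (N + k)%N <= w - u.
  have cv : M^-1 ^+ n @[n --> \oo] --> (0 : R).
    by apply: cvg_expr; rewrite ger0_norm ?invr_ge0 ?invf_lt1 // ltW.
  have [k _ Hk] := cvgr_lt _ cv _ r0.
  exists k; apply: le_trans (atom_scale_le _) (ltW (Hk _ _)); rewrite /= ?leq_addl//.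
case: (ex_minnP ex) => -[|k]; first by rewrite addn0 leNgt uwN.
move=> hk mk.
have {}mk : w - u < atom_scale (N + k).
  by rewrite ltNge; apply/negP => /mk; rewrite ltnn.
have u1 : w <= u + 1.
  have := lt_le_trans mk (atom_scale_le _).
  have : M^-1 ^+ (N + k) <= 1.
    by rewrite exprn_ile1 ?invr_ge0 ?invf_le1 ?(ltW hM) ?(ltW M0).
  lra.
apply: le_trans (Hh _ _ _ (leq_addr k N) _ mk) _; first by rewrite ltW.
rewrite -mulrA ler_pM2l // (le_trans (HC _ (leq_addr k N))) // ler_pM2l //.
by rewrite ge0_ler_powR ?nnegrE ?(ltW s0) ?(ltW r0) ?(ltW (atom_scale_gt0 _)) -?addnS.
Qed.

End Scales.

(** * Mass distribution *)

Section MassDistribution.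
Context (R : realType) (mu : probability (circle R) R).
Implicit Types (x y z : circle R) (U X : set (circle R)).

Lemma ccw_itv x y : 0 <= ccw x y < 1.
Proof.
have [s [sx <-]] := circle_point_above (repr x) y.
by rewrite -(circle_projK x) ccw_proj //; lra.
Qed.

Lemma circle_dist_ge0 x y : 0 <= circle_dist x y.
Proof.
by rewrite /circle_dist le_min; have := ccw_itv x y; have := ccw_itv y x; lra.
Qed.

Lemma circle_dist_le_diam U x y : U x -> U y -> circle_dist x y <= diam U.
Proof.
move=> Ux Uy; apply: ub_le_sup; last by exists x, y.
exists 1 => _ [v [w [_ _ ->]]].
by rewrite /circle_dist ge_min; have := ccw_itv v w; lra.
Qed.

(** The signed displacement t is positive or negative according to which of the two
    directions realizes the distance. *)
Lemma circle_dist_proj x y : exists t,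
  `|t| = circle_dist x y /\ y = circle_proj (repr x + t).
Proof.
have [xy0 _] := andP (ccw_itv x y); have [yx0 _] := andP (ccw_itv y x).
rewrite /circle_dist /Num.min; case: ifP => _.
  have [s [sx E]] := circle_point_above (repr x) y.
  exists (s - repr x).
  split; last by rewrite addrC subrK E.
  by rewrite -E -{2}(circle_projK x) ccw_proj // ger0_norm //; lra.
have [s [sx E]] := circle_point_above (repr y) x.
have /circle_projP[m sm] : circle_proj s = circle_proj (repr x) by rewrite E circle_projK.
exists (repr y - s); split.
  by rewrite -E -{2}(circle_projK y) ccw_proj // distrC ger0_norm //; lra.
have -> : repr x + (repr y - s) = repr y + (- m)%:~R by rewrite sm mulrNz; lra.
by rewrite circle_projD circle_projK.
Qed.

(** A cover by small sets with sum of diam^s below 1/(2C) would give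
    mu(X) <= 1/2. The sets U are replaced by measurable supersets K since a
    covering set is arbitrary. *)
Lemma mass_distribution (s C delta : R) X : 0 < delta -> 0 < C ->
  (forall U, diam U <= delta -> exists K, [/\ measurable K, U `<=` K &
     (mu K <= C%:E * diam_pow s U)%E]) ->
  measurable X -> mu X = 1%E -> hausdorff_measure s X <> 0%E.
Proof.
move=> delta0 C0 HU mX X1 H0.
have : (hausdorff_premeasure s delta X < (C^-1 / 2)%:E)%E.
  apply: (@le_lt_trans _ _ 0%E); last by rewrite lte_fin divr_gt0 ?invr_gt0.
  by rewrite -H0; apply: ereal_sup_ubound; exists delta.
move=> /ereal_inf_lt[_ [U [XU dU] <-] sumU].
have [K HK] := choice (fun k => HU (U k) (dU k)).
have dp0 k : (0 <= diam_pow s (U k))%E.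
  by rewrite /diam_pow; case: asboolP => // _; rewrite lee_fin powR_ge0.
have : (mu X <= \sum_(0 <= k <oo) mu (K k))%E.
  apply: measure_sigma_subadditive => //.
    by move=> k; have [] := HK k.
  by move=> x /XU[k _ Ukx]; exists k => //; have [_ + _] := HK k; apply.
have : (\sum_(0 <= k <oo) mu (K k) <= \sum_(0 <= k <oo) C%:E * diam_pow s (U k))%E.
  by apply: lee_nneseries => k *; [exact: measure_ge0|by have [] := HK k].
rewrite nneseriesZl; last by move=> k _; exact: dp0.
move=> h1 h2; have := le_trans h2 h1; rewrite X1.
apply/negP; rewrite -ltNge.
have : (C%:E * \sum_(0 <= k <oo) diam_pow s (U k) < C%:E * (C^-1 / 2)%:E)%E.
  by rewrite lte_pmul2l // lte_fin.
move=> h3; apply: lt_trans h3 _; rewrite -EFinM lte_fin mulrA divff ?gt_eqF //.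
lra.
Qed.

(** The point lies in arcs of arbitrarily small length; r is chosen so that the arc of
    length r has at most half the mass that the point would have. *)
Lemma atomless_of_holder (s C eps : R) x : 0 < s -> 0 < C -> 0 < eps ->
  (forall u w : R, u < w -> w - u < eps -> arc_mass mu u w <= C * (w - u) `^ s) ->
  mu [set x] = 0%E.
Proof.
move=> s0 C0 eps0 H; apply/eqP; rewrite eq_le measure_ge0 andbT leNgt; apply/negP.
have mx := measurable_circle1 x.
rewrite -[mu _]fineK ?fin_num_measure // lte_fin.
set m := fine _ => m0.
pose r := Num.min (eps / 2) ((m / (2 * C)) `^ s^-1).
have r0 : 0 < r.
  rewrite lt_min divr_gt0 //= powR_gt0 // divr_gt0 // mulr_gt0 //.
have re : r < eps by rewrite gt_min; apply/orP; left; lra.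
have rs : r `^ s <= m / (2 * C).
  have -> : m / (2 * C) = ((m / (2 * C)) `^ s^-1) `^ s.
    by rewrite -powRrM mulVf ?gt_eqF // powRr1 // divr_ge0 ?mulr_ge0 // ltW.
  rewrite ge0_ler_powR ?nnegrE ?(ltW s0) ?(ltW r0) ?powR_ge0 //.
  by rewrite ge_min lexx orbT.
have := H (repr x) (repr x + r); rewrite ltrDl addrAC subrr add0r => /(_ r0 re).
have : m <= arc_mass mu (repr x) (repr x + r).
  rewrite fine_le ?fin_num_measure //; first exact: measurable_arc.
  apply: le_measure; rewrite ?inE //; first exact: measurable_arc.
  move=> _ ->; exists (repr x); last by rewrite circle_projK.
  by rewrite /= in_itv /= lexx ltrDl.
move=> h1 h2; have := le_trans h1 h2; apply/negP; rewrite -ltNge.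
apply: (@le_lt_trans _ _ (C * (m / (2 * C)))); first by rewrite ler_pM2l.
have -> : C * (m / (2 * C)) = m / 2 by field; rewrite gt_eqF.
lra.
Qed.

(** A set of diameter d > 0 lies in an arc of length 4 d centred at any of its points.
    When d = 0 no arc of positive length is small enough, but the set is then a
    single point, which has mass 0. *)
Lemma holder_cover (s C eps : R) U : 0 < s -> 0 < C -> 0 < eps ->
  (forall u w : R, u < w -> w - u < eps -> arc_mass mu u w <= C * (w - u) `^ s) ->
  diam U <= eps / 8 ->
  exists K, [/\ measurable K, U `<=` K & (mu K <= (C * 4 `^ s)%:E * diam_pow s U)%E].
Proof.
move=> s0 C0 eps0 H dU.
have [U0|/set0P[x Ux]] := eqVneq U set0.
  exists set0; split=> //; first by rewrite U0.
  by rewrite measure0 /diam_pow; case: asboolP => // _; rewrite mule0.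
rewrite /diam_pow; case: asboolP => [U0|_]; first by rewrite U0 in Ux.
have d0 : 0 <= diam U.
  exact: le_trans (circle_dist_ge0 x x) (circle_dist_le_diam Ux Ux).
have [dpos|dneg] := ltP 0 (diam U).
  exists (proj_arc (repr x - 2 * diam U) (repr x + 2 * diam U)).
  split; first exact: measurable_arc.
    move=> y Uy; have [t [td ->]] := circle_dist_proj x y.
    have := circle_dist_le_diam Ux Uy; rewrite -td ler_norml => tU.
    by exists (repr x + t) => //=; rewrite in_itv /=; lra.
  rewrite arc_massE -EFinM lee_fin -mulrA -powRM //.
  have -> : 4 * diam U = (repr x + 2 * diam U) - (repr x - 2 * diam U) by ring.
  by apply: H; lra.
have {}dneg : diam U = 0 by apply/eqP; rewrite eq_le dneg d0.
exists [set x]; split; first exact: measurable_circle1.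
  move=> y Uy; have [t [td ->]] := circle_dist_proj x y.
  have := circle_dist_le_diam Ux Uy; rewrite -td dneg normr_le0 => /eqP ->.
  by rewrite addr0 circle_projK.
by rewrite (atomless_of_holder x s0 C0 eps0 H) mule_ge0 // lee_fin
  ?powR_ge0 // mulr_ge0 ?powR_ge0 // ltW.
Qed.

End MassDistribution.

Theorem proposition3p4 (R : realType) (M : R) (hM : 1 < M)
  (hMbounds : real_bounds_property M)
  (f : circle R -> circle R) (rho : R) (a : nat -> nat) (tau : R)
  (mu : probability (circle R) R)
  (hf : multicritical 3 f) (hrho : rotation_number f rho)
  (hirr : irrational rho) (ha : cfrac_expansion rho a)
  (hmu : invariant_measure mu f)
  (htau : 0 <= tau) (hdioph : diophantine_class tau rho) :
  let nu1 : \bar R := limn_esup (fun n : nat =>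
    (2 * ln ((\prod_(1 <= i < n.+1) a i)%N%:R) / ln ((return_time a n)%:R))%:E) in
  let nu2 : \bar R := limn_esup (fun n : nat =>
    (n%:R / ln ((return_time a n)%:R))%:E) in
  (1 / ((2 * tau)%:E + nu1 + nu2 * (ln M)%:E) <= hausdorff_dim_measure mu)%E.
Proof.
lazy zeta; rewrite div1e.
apply: le_ereal_inf_tmp => _ [X [mX X1] <-].
apply: le_ereal_inf_tmp => _ [s [s0 HX] <-].
rewrite leNgt; apply/negP => sD; move: HX.
(* For s = 0 each nonempty set of a cover contributes 1, a bound for its mass. *)
have [s_eq0|s_neq0] := eqVneq s 0.
  apply: (@mass_distribution _ mu s 1 1) => // U _; rewrite s_eq0 mul1e /diam_pow.
  case: asboolP => [->|_]; first by exists set0; split; rewrite ?measure0.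
  by exists setT; split; rewrite ?powRr0 ?probability_setT.
have {s_neq0}s0 : 0 < s by rewrite lt_neqAle eq_sym s_neq0.
have [a_gt0 a_rho] := ha.
have [gamma gamma0 dio] := hdioph.
have [G [GL mu_G]] := semiconjugacy hmu hrho.
have [_ [F [_ _ _ [c fc] _]]] := hf.
have [n0 bounds] := hMbounds f rho a hf hrho hirr ha.
have [C C0 [N HN]] := atom_scale_lower_bound hM a_gt0 a_rho s0 gamma0 dio sD.
pose N' := maxn N (maxn n0 1).
have light n (u w : R) : (N' <= n)%N -> u <= w <= u + 1 ->
    w - u < atom_scale M a n -> angle mu w - angle mu u <= 5 / (return_time a n)%:R.
  rewrite !geq_max => /and3P[_ n0n n1] uw uwn; rewrite leNgt; apply/negP.
  case: n n0n n1 uwn => // n n0n n1 uwn heavy.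
  have [i iq] := heavy_arc_contains_dyn_arc GL mu_G a_gt0 a_rho c uw heavy.
  apply/negP; rewrite -ltNge; apply: lt_le_trans uwn _.
  have [_ _ _ _ lower] := bounds n.+1 n1 n0n c fc.
  by apply: lower; left; exists i.
have HN' n : (N' <= n)%N -> (return_time a n)%:R^-1 <= C * atom_scale M a n.+1 `^ s.
  by rewrite geq_max => /andP[? _]; exact: HN.
have holder := uniform_arc_bound hM a_gt0 s0 C0 HN' light.
have eps0 : 0 < atom_scale M a N' by exact: atom_scale_gt0.
have eps1 : atom_scale M a N' <= 1.
  apply: le_trans (atom_scale_le hM a_gt0 _) _.
  have M0 : 0 < M := lt_trans ltr01 hM.
  by rewrite exprn_ile1 ?invr_ge0 ?invf_le1 ?(ltW hM) ?(ltW M0).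
have C50 : 0 < 5 * C by rewrite mulr_gt0.
apply: (@mass_distribution _ mu s (5 * C * 4 `^ s) (atom_scale M a N' / 8)) => //.
- by rewrite divr_gt0.
- by rewrite mulr_gt0 ?powR_gt0.
move=> U dU; apply: holder_cover dU => // u w uw uwe.
by rewrite -angleB; [exact: holder|lra].
Qed.
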